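(* Let $(X_t)_{t\ge0}$ be an ergodic birth–death process on $\mathbb{N}=\{0,1,2,\dots\}$ with birth rates $(\lambda_x)_{x\ge0}$ and death rates $(\nu_x)_{x\ge0}$, let $u$ be a positive function on $\mathbb{N}$ (with the convention $u_{-1}:=1$), and let $\delta$ be the metric on $\mathbb{N}$ given by $$\delta(x,y)=\left|\sum_{k=0}^{x-1}u_k-\sum_{k=0}^{y-1}u_k\right|.$$ Assume that $P_t(x,\cdot)\in\mathscr{P}_\delta(\mathbb{N})$ for all $t>0$ and $x\in\mathbb{N}$. Then the Wasserstein curvature $\sigma_\delta$ of $(X_t)_{t\ge0}$ with respect to the metric $\delta$ is given by $$\sigma_\delta=\inf_{x\in\mathbb{N}}\left\{\nu_{x+1}+\lambda_x-\nu_x\frac{u_{x-1}}{u_x}-\lambda_{x+1}\frac{u_{x+1}}{u_x}\right\}.$$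
   Context: Birth–death process: $(X_t)_{t\ge0}$ is the $\mathbb{N}$-valued càdlàg Markov jump process with generator, for $f:\mathbb{N}\to\mathbb{R}$, $$\mathcal{L}f(x)=\lambda_x(f(x+1)-f(x))+\nu_x(f(x-1)-f(x)),\qquad x\in\mathbb{N},$$ where $\lambda_x>0$ for all $x\ge0$, $\nu_x>0$ for all $x\ge1$, and $\nu_0=0$. Its transition kernel is stable and conservative. It is ergodic in the sense that, with $\mu(0)=1$ and $\mu(x)=\frac{\lambda_0\lambda_1\cdots\lambda_{x-1}}{\nu_1\nu_2\cdots\nu_x}$ for $x\ge1$, $$\sum_{x\ge0}\mu(x)\sum_{y\ge x}\frac{1}{\mu(y)\lambda_y}=+\infty,\qquad \sum_{x\ge0}\mu(x)<+\infty.$$ Write $P_t(x,\cdot)=\mathbb{P}_x(X_t\in\cdot)$ and $P_tf(x)=\mathbb{E}_x[f(X_t)]$. $\mathscr{P}_\delta(\mathbb{N})$ is the set of probability measures $m$ on $\mathbb{N}$ with $\sum_{y}\delta(x,y)m(y)<+\infty$ for some (equivalently all) $x$. For $f:\mathbb{N}\to\mathbb{R}$, $\|f\|_{\mathrm{Lip}_\delta}:=\sup_{x\neq y}|f(x)-f(y)|/\delta(x,y)$, and $\mathrm{Lip}_\delta(\mathbb{N})$ is the set of $f$ for which this is finite. Wasserstein curvature: let $\bar\sigma_\delta(t):=-\sup\{\log\|P_tf\|_{\mathrm{Lip}_\delta}:\|f\|_{\mathrm{Lip}_\delta}=1\}$ for $t\ge0$, with $\bar\sigma_\delta(0)=0$.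 Then $\sigma_\delta:=\lim_{t\downarrow0}\bar\sigma_\delta(t)/t=\inf_{t>0}\bar\sigma_\delta(t)/t$, possibly equal to $-\infty$; equivalently it is the best (maximal) constant $\alpha$ such that $\|P_tf\|_{\mathrm{Lip}_\delta}\le e^{-\alpha t}\|f\|_{\mathrm{Lip}_\delta}$ for all $f\in\mathrm{Lip}_\delta(\mathbb{N})$, $t>0$. The identity in the claim includes the case where both sides equal $-\infty$. Empty sums are $0$. *)

(* Defs.v *)
From HB Require Import structures.
From mathcomp Require Import all_boot all_order all_algebra.
From mathcomp Require Import all_classical all_reals all_analysis.

Set Implicit Arguments.
Unset Strict Implicit.
Unset Printing Implicit Defensive.

Import Order.TTheory GRing.Theory Num.Theory.
Import numFieldNormedType.Exports.

Local Open Scope classical_set_scope.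
Local Open Scope ring_scope.

Section BirthDeath.
Context {R : realType}.
Implicit Types (lambda nu u f : nat -> R) (delta : nat -> nat -> R).

Definition birth_death_rates lambda nu :=
  [/\ forall x, 0 < lambda x, forall x, 0 < nu x.+1 & nu 0%N = 0].

(* At [x = 0] the junk value [0.-1 = 0] is harmless: the second term vanishes. *)
Definition birth_death_generator lambda nu f (x : nat) : R :=
  lambda x * (f x.+1 - f x) + nu x * (f x.-1 - f x).

Definition reversing_measure lambda nu (x : nat) : R :=
  (\prod_(0 <= k < x) lambda k) / (\prod_(1 <= k < x.+1) nu k).

Definition ergodic lambda nu :=
  let mu := reversing_measure lambda nu in
  (\sum_(0 <= x <oo)
      ((mu x)%:E * \sum_(x <= y <oo) ((mu y * lambda y)^-1)%:E) = +oo)%E /\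
  (\sum_(0 <= x <oo) (mu x)%:E < +oo)%E.

Definition lip_norm delta f : \bar R :=
  ereal_sup [set (`|f p.1 - f p.2| / delta p.1 p.2)%:E
            | p in [set p : nat * nat | p.1 != p.2]].

Definition finite_delta_moment delta (m : probability nat R) :=
  exists x, (\sum_(0 <= y <oo) (delta x y)%:E * m [set y] < +oo)%E.

Definition path_metric u (x y : nat) : R :=
  `|\sum_(0 <= k < x) u k - \sum_(0 <= k < y) u k|.

(* [upred u x] is [u_(x-1)], with the convention [u_(-1) = 1]. *)
Definition upred u (x : nat) : R := if x is k.+1 then u k else 1.

End BirthDeath.

(* A Markov family: [Px x] is the law under which [X] starts at [x].  Time is
   indexed by [R], but only the variables [X t] with [0 <= t] matter. *)
Section Process.
Context {R : realType} {d : measure_display} {Omega : measurableType d}.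
Variables (Px : nat -> probability Omega R) (X : R -> {mfun Omega >-> nat}).

(* [nat] carries the discrete topology, so that these limits say that paths are
   piecewise constant. *)
Definition cadlag :=
  forall w,
    (forall t : R, 0 <= t -> X r w @[r --> t^'+] --> X t w) /\
    (forall t : R, 0 < t -> cvg (X r w @[r --> t^'-])).

Definition past_events (s : R) : set (set Omega) :=
  <<s [set A | exists (r : R) (B : set nat), [/\ 0 <= r, r <= s & A = X r @^-1` B]] >>.

Definition markov_property :=
  forall x (s t : R) A y z, 0 <= s -> 0 <= t -> past_events s A ->
    (Px x (A `&` [set w | X s w = y] `&` [set w | X (s + t) w = z]) =
     Px x (A `&` [set w | X s w = y]) * Px y [set w | X t w = z])%E.

Definition transition (t : R) (x : nat) : probability nat R :=
  distribution (Px x) (X t).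

(* [P_t f (x) = E_x(f(X_t))].  It is meaningful when [f] is integrable against
   [transition t x]; otherwise it is an unspecified real. *)
Definition semigroup (t : R) (f : nat -> R) (x : nat) : R :=
  fine ('E_(Px x)[f \o X t])%E.

(* The generator is taken pointwise on bounded functions; on indicators this
   gives the q-matrix of the process, which is stable and conservative. *)
Definition has_generator (L : (nat -> R) -> nat -> R) :=
  forall f, (exists M : R, forall x, `|f x| <= M) ->
  forall x, t^-1 * (semigroup t f x - f x) @[t --> 0^'+] --> L f x.

Record birth_death_process (lambda nu : nat -> R) : Prop := {
  bdp_rates : birth_death_rates lambda nu;
  bdp_start : forall x, Px x [set w | X 0 w = x] = 1%E;
  bdp_cadlag : cadlag;
  bdp_markov : markov_property;
  bdp_generator : has_generator (birth_death_generator lambda nu) }.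

(* [lne 0 = -oo] and [lne +oo = +oo]. *)
Definition curvature_upto delta (t : R) : \bar R :=
  (- ereal_sup [set lne (lip_norm delta (semigroup t f))
               | f in [set f | lip_norm delta f = 1]])%E.

Definition wasserstein_curvature delta : \bar R :=
  lim ((curvature_upto delta t * (t^-1)%:E)%E @[t --> 0^'+]).

End Process.

(* Main.v *)
Require Import Defs.
From HB Require Import structures.
From mathcomp Require Import all_boot all_order all_algebra.
From mathcomp Require Import all_classical all_reals all_analysis.
From mathcomp Require Import measurable_realfun ring lra.

Set Implicit Arguments.
Unset Strict Implicit.
Unset Printing Implicit Defensive.

Import Order.TTheory GRing.Theory Num.Theory.
Import numFieldNormedType.Exports.

Local Open Scope classical_set_scope.
Local Open Scope ring_scope.

(** Write [w x = u_0 + ... + u_(x-1)], so that the metric is [|w x - w y|], and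
    let [V x] be the expression whose infimum is claimed to be the curvature.
    Everything rests on the identity [L w (x+1) - L w x = - V x * u x]
    ([generator_path_length_increment]): [V x] is the rate at which the generator
    contracts the edge between [x] and [x + 1].

    Upper bound.  Stop [w] beyond [x + 2].  This gives a bounded function of
    Lipschitz norm 1, to which the generator applies, and the slope of its image
    under [P_t] between [x] and [x + 1] is [1 - t V x + o(t)].  Hence the curvature
    up to time [t], divided by [t], is eventually at most [V x + e]
    ([curvature_upto_le]).

    Lower bound.  Let [alpha <= V x] for all [x].  For bounded [f] with
    [f y - f x <= w y - w x] whenever [x <= y], the function
    [(t, x, y) |-> P_t f y - P_t f x] solves the backward equation of two
    independent copies of the process, run until they meet: neighbouring
    jumps preserve the order [x <= y], and the function vanishes on the diagonal.
    Since [L w y - L w x <= - alpha (w y - w x)], the function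
    [exp(- alpha t) (w y - w x)] is a supersolution which dominates at time 0 and
    on the diagonal.  A comparison principle on the infinite set of pairs needs
    control at infinity, and this is where ergodicity enters.  The mean time
    [psi n] that the process takes to go from 0 to [n] satisfies [L psi = 1], and
    the divergence of the first series in the definition of ergodicity is
    precisely [psi n -> +oo] ([mean_passage_time_unbounded]).  So after adding
    [eps (3 t + 1 + psi x + psi y)] to the supersolution, the comparison can fail
    only on a finite set of pairs, where a first-touching argument excludes it
    ([barrier]).  Letting [eps -> 0] yields
    [P_t f y - P_t f x <= exp(- alpha t) (w y - w x)] ([semigroup_contraction]).
    The moment assumption and dominated convergence extend this to all
    Lipschitz [f] by truncation ([semigroup_lipschitz]), so that the curvature up
    to time [t], divided by [t], is at least [alpha] for every [t]
    ([curvature_upto_ge]).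

    The two bounds identify the limit, whether the infimum of [V] is finite or
    not ([cvg_ereal_inf]). *)

(** * The semigroup on bounded functions *)

Definition bounded_fn {R : realType} (f : nat -> R) :=
  exists M : R, forall x, `|f x| <= M.

(** The part of the process that the argument uses: an action on bounded
    functions.  Unbounded functions are excluded because the expectation that
    defines the action is then a default value unless it is finite. *)
Record markov_semigroup {R : realType} (T : R -> (nat -> R) -> nat -> R) := {
  ms_cst : forall t c x, T t (fun=> c) x = c;
  ms_add : forall t f g x, bounded_fn f -> bounded_fn g ->
    T t (fun y => f y + g y) x = T t f x + T t g x;
  ms_scale : forall t c f x, bounded_fn f ->
    T t (fun y => c * f y) x = c * T t f x;
  ms_ge0 : forall t f x, bounded_fn f -> (forall y, 0 <= f y) -> 0 <= T t f x;
  ms_comp : forall s t f x, 0 <= s -> 0 <= t -> bounded_fn f ->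
    T (s + t) f x = T s (T t f) x;
  ms_start : forall x : nat, T 0 (fun y => (y == x)%:R) x = 1 }.

Section Prob.
Context {R : realType} {d : measure_display} {Omega : measurableType d}.
Variables (Px : nat -> probability Omega R) (X : R -> {mfun Omega >-> nat}).

Lemma semigroupE t f x :
  semigroup Px X t f x = \int[Px x]_(w in setT) f (X t w).
Proof. by rewrite /semigroup expectation.unlock. Qed.

Lemma measurable_path t (f : nat -> R) : measurable_fun setT (fun w => f (X t w)).
Proof. by apply: (@measurableT_comp _ _ _ _ _ _ f) => //. Qed.

Lemma measurable_path_eq t (y : nat) : measurable [set w | X t w = y].
Proof.
rewrite -[X in measurable X]setTI.
exact: (measurable_funP (X t) measurableT [set y]).
Qed.

Lemma integrable_path t f x : bounded_fn f ->
  (Px x).-integrable setT (EFin \o (fun w => f (X t w))).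
Proof.
move=> [M fM]; apply: measurable_bounded_integrable => //.
- by rewrite (le_lt_trans (probability_le1 _ _))// ltry.
- exact: measurable_path.
- exists M; split; first exact: num_real.
  by move=> y My w _; apply: (le_trans (fM _)); exact: ltW.
Qed.

Lemma integral_path t x (f : nat -> R) : (forall y, 0 <= f y) ->
  (\int[Px x]_w (f (X t w))%:E =
   \sum_(0 <= y <oo) (f y)%:E * Px x [set w | X t w = y])%E.
Proof.
move=> f0.
pose F (y : nat) := [set w | X t w = y].
have mF y : measurable (F y).
  exact: measurable_path_eq.
have FT : \bigcup_y F y = setT.
  by apply/seteqP; split => // w _; exists (X t w).
rewrite -{1}FT ge0_integral_bigcup//.
- apply: eq_eseriesr => y _.
  rewrite (eq_integral (cst (f y)%:E)); first by rewrite integral_cst.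
  by move=> w; rewrite inE /F /= => <-.
- by rewrite FT; apply/measurable_EFinP; exact: measurable_path.
- by move=> w _; rewrite lee_fin.
- apply/trivIsetP => i j _ _ ij.
  by apply/seteqP; split => // w [/= Xi Xj]; move: ij; rewrite -Xi -Xj eqxx.
Qed.

Hypothesis mk : markov_property Px X.
Hypothesis start : forall x, Px x [set w | X 0 w = x] = 1%E.

(** The Markov property with no conditioning on the past before [s], summed over
    the position at time [s]. *)
Lemma chapman_kolmogorov (s t : R) x z : 0 <= s -> 0 <= t ->
  (Px x [set w | X (s + t) w = z] =
   \sum_(0 <= y <oo) Px x [set w | X s w = y] * Px y [set w | X t w = z])%E.
Proof.
move=> s0 t0.
pose F (y : nat) := [set w | X s w = y] `&` [set w | X (s + t) w = z].
have mF y : measurable (F y).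
  by apply: measurableI; exact: measurable_path_eq.
have -> : [set w | X (s + t) w = z] = \bigcup_y F y.
  by apply/seteqP; split => [w /= Xz|w [y _ [_ ?]]] //; exists (X s w).
rewrite measure_semi_bigcup//; [|apply/trivIsetP|exact: bigcup_measurable]; last first.
  move=> i j _ _ ij.
  by apply/seteqP; split => // w [[/= Xi _] [Xj _]]; move: ij; rewrite -Xi -Xj eqxx.
apply: eq_eseriesr => y _.
have pT : past_events X s setT.
  by apply: sub_sigma_algebra; exists 0, setT.
by have := mk x y z s0 t0 pT; rewrite setTI.
Qed.

Lemma semigroup_bounded t (f : nat -> R) M x : (forall y, `|f y| <= M) -> 
  `|semigroup Px X t f x| <= M.
Proof.
move=> fM; have bf : bounded_fn f by exists M.
rewrite semigroupE; apply: le_trans (le_normr_Rintegral _ _) _ => //.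
  exact: integrable_path.
have -> : M = \int[Px x]_(w in setT) M.
  by rewrite Rintegral_cst//= probability_setT mulr1.
apply: le_Rintegral => //.
- by apply: (@integrable_path t (fun y => `|f y|)); exists M => y; rewrite normr_id.
- by apply: (@integrable_path t (fun y => M)); exists `|M|.
Qed.

(** For nonnegative functions the expectations are series of extended reals, so
    the Chapman-Kolmogorov sum can be exchanged with them freely; the bounded
    case follows by adding a constant. *)
Lemma semigroup_ge0_comp (s t : R) (f : nat -> R) x : 0 <= s -> 0 <= t -> bounded_fn f ->
  (forall y, 0 <= f y) ->
  semigroup Px X (s + t) f x = semigroup Px X s (semigroup Px X t f) x.
Proof.
move=> s0 t0 bf f0.
have g0 y : 0 <= semigroup Px X t f y.
  by rewrite semigroupE Rintegral_ge0.
rewrite [LHS]semigroupE [RHS]semigroupE; congr fine.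
rewrite !integral_path//.
under eq_eseriesr => z _.
  rewrite chapman_kolmogorov// -nneseriesZl; last by move=> *; exact: mule_ge0.
  over.
rewrite /= nneseries_interchange; last first.
  by move=> i j; rewrite !mule_ge0// lee_fin.
apply: eq_eseriesr => y _.
rewrite semigroupE fineK; last first.
  by apply: integrable_fin_num => //; exact: integrable_path.
have /fineK <- : Px x [set w | X s w = y] \is a fin_num.
  by apply: fin_num_measure; exact: measurable_path_eq.
rewrite integral_path// [RHS]muleC -nneseriesZl; last first.
  by move=> i _; rewrite mule_ge0 // lee_fin.
by apply: eq_eseriesr => z _; rewrite muleCA.
Qed.

Lemma semigroup_markov : markov_semigroup (semigroup Px X).
Proof.
have cstE t c x : semigroup Px X t (fun=> c) x = c.
  by rewrite semigroupE Rintegral_cst//= probability_setT mulr1.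
have addE t f g x : bounded_fn f -> bounded_fn g ->
  semigroup Px X t (fun y => f y + g y) x =
  semigroup Px X t f x + semigroup Px X t g x.
  move=> bf bg; rewrite !semigroupE RintegralD//; exact: integrable_path.
split => //.
- by move=> t c f x bf; rewrite !semigroupE RintegralZl//; exact: integrable_path.
- by move=> t f x bf f0; rewrite semigroupE Rintegral_ge0.
- move=> s t f x s0 t0 [M fM].
  have bf : bounded_fn f by exists M.
  have bM : bounded_fn (fun _ : nat => M) by exists `|M|.
  have bg : bounded_fn (semigroup Px X t f).
    by exists M => y; exact: semigroup_bounded.
  have := @semigroup_ge0_comp s t (fun y => f y + M) x s0 t0.
  rewrite addE// cstE.
  have -> : semigroup Px X t (fun y => f y + M) = fun y => semigroup Px X t f y + M.
    by apply/funext => y; rewrite addE// cstE.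
  rewrite addE// cstE => h; apply: (addIr M); apply: h.
    exists (M + M) => y; rewrite (le_trans (ler_normD _ _))// lerD// ger0_norm//.
    exact: le_trans (fM 0%N).
  by move=> y; have := fM y; rewrite ler_norml; lra.
- move=> x; rewrite semigroupE /Rintegral (@integral_path 0 x (fun y => (y == x)%:R))//.
  rewrite (nneseriesD1 (n := x))//=; last by move=> i _; rewrite mule_ge0// lee_fin.
  rewrite eqxx start mule1 eseries0 ?adde0// => i _ /= /negPf ix.
  by rewrite ix mul0e.
Qed.

End Prob.

Section BoundedFn.
Context {R : realType}.
Implicit Types f g : nat -> R.

Lemma bounded_fn_cst (c : R) : bounded_fn (fun=> c).
Proof. by exists `|c|. Qed.

Lemma bounded_fnD f g :
  bounded_fn f -> bounded_fn g -> bounded_fn (fun y => f y + g y).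
Proof.
move=> [M fM] [N gN]; exists (M + N) => x.
by rewrite (le_trans (ler_normD _ _))// lerD.
Qed.

Lemma bounded_fnZ c f : bounded_fn f -> bounded_fn (fun y => c * f y).
Proof. by move=> [M fM]; exists (`|c| * M) => x; rewrite normrM ler_wpM2l. Qed.

Lemma bounded_fn_indicator (x : nat) : @bounded_fn R (fun y => (y == x)%:R).
Proof. by exists 1 => y; case: (y == x); rewrite ?normr0 ?normr1. Qed.

End BoundedFn.

Section MarkovSemigroup.
Context {R : realType} (T : R -> (nat -> R) -> nat -> R).
Hypothesis mT : markov_semigroup T.
Implicit Types f g : nat -> R.

Lemma markov_semigroup_le t f g x : bounded_fn f -> bounded_fn g ->
  (forall y, f y <= g y) -> T t f x <= T t g x.
Proof.
move=> bf bg fg; have bNf := bounded_fnZ (-1) bf.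
have : 0 <= T t (fun y => g y + (-1) * f y) x.
  apply: (ms_ge0 mT); first exact: bounded_fnD.
  by move=> y; rewrite mulN1r subr_ge0.
by rewrite (ms_add mT)// (ms_scale mT)// mulN1r subr_ge0.
Qed.

Lemma markov_semigroup_norm_le t f M x : (forall y, `|f y| <= M) -> `|T t f x| <= M.
Proof.
move=> fM; have bf : bounded_fn f by exists M.
rewrite ler_norml -{1}(ms_cst mT t (- M) x) -{2}(ms_cst mT t M x).
apply/andP; split; apply: markov_semigroup_le => //; try exact: bounded_fn_cst.
- by move=> y; have := fM y; rewrite ler_norml => /andP[].
- by move=> y; have := fM y; rewrite ler_norml => /andP[].
Qed.

Lemma markov_semigroup_bounded t f : bounded_fn f -> bounded_fn (T t f).
Proof. by move=> [M fM]; exists M => x; exact: markov_semigroup_norm_le. Qed.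

(** The position has moved away from [x] with probability [1 - T t 1_x x], and
    only then can [f] change, by at most [2 M].  The bound depends on [f] through
    [M] alone. *)
Lemma markov_semigroup_displacement t f M x : (forall y, `|f y| <= M) ->
  `|T t f x - f x| <= 2 * M * (1 - T t (fun y => (y == x)%:R) x).
Proof.
move=> fM; have bf : bounded_fn f by exists M.
have b1 := bounded_fn_cst (1 : R); have bi := @bounded_fn_indicator R x.
have bNi := bounded_fnZ (-1) bi; have b1i := bounded_fnD b1 bNi.
have bg := bounded_fnZ (2 * M) b1i.
have gE : T t (fun y => 2 * M * (1 + (-1) * (y == x)%:R)) x =
    2 * M * (1 - T t (fun y => (y == x)%:R) x).
  by rewrite (ms_scale mT)// (ms_add mT)// (ms_cst mT) (ms_scale mT)// mulN1r.
have key c : `|c| = 1 ->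
    c * (T t f x - f x) <= 2 * M * (1 - T t (fun y => (y == x)%:R) x).
  move=> c1; have bcf := bounded_fnZ c bf; have bcx := bounded_fn_cst (- (c * f x)).
  rewrite -gE mulrBr -(ms_scale mT)// -[X in _ + X](ms_cst mT t _ x) -(ms_add mT)//.
  apply: markov_semigroup_le => //; first exact: bounded_fnD.
  move=> y; have [->|yx] := eqVneq y x.
    by rewrite mulr1 !subrr mulr0.
  rewrite mulr0 addr0 mulr1 -mulrBr.
  apply: le_trans (ler_norm _) _; rewrite normrM c1 mul1r.
  rewrite (le_trans (ler_normB _ _))//; have := fM y; have := fM x; lra.
rewrite ler_norml; apply/andP; split.
  by rewrite lerNl -mulN1r; apply: key; rewrite normrN normr1.
by rewrite -[X in X <= _]mul1r; apply: key; rewrite normr1.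
Qed.

Lemma markov_semigroup0 f x : bounded_fn f -> T 0 f x = f x.
Proof.
move=> [M fM]; apply/eqP; rewrite -subr_eq0 -normr_le0.
by rewrite (le_trans (markov_semigroup_displacement 0 x fM))// (ms_start mT) subrr mulr0.
Qed.

Variable L : (nat -> R) -> nat -> R.
Hypothesis genL : forall f, bounded_fn f ->
  forall x, t^-1 * (T t f x - f x) @[t --> 0^'+] --> L f x.

Lemma markov_semigroup_cvg0 f x : bounded_fn f -> T h f x @[h --> 0^'+] --> f x.
Proof.
move=> bf.
have h0 : (h : R) @[h --> 0^'+] --> (0 : R).
  by apply: cvg_at_right_filter; exact: cvg_id.
have H : h * (h^-1 * (T h f x - f x)) + f x @[h --> 0^'+] --> f x.
  rewrite -[X in _ --> X](_ : 0 * L f x + f x = _); last by rewrite mul0r add0r.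
  by apply: cvgD; [apply: cvgM => //; exact: genL|exact: cvg_cst].
apply: cvg_trans H; apply: near_eq_cvg.
near=> h; rewrite /= mulrA mulfV ?mul1r ?subrK// gt_eqF//.
Unshelve. all: by end_near. Qed.

(** Writing [T t] as [T h] applied to [T (t - h)] makes the one-sided
    displacement bound uniform in the past, hence controls left increments. *)
Lemma markov_semigroup_left_increment t f x : 0 < t -> bounded_fn f ->
  exists2 c : R -> R, c h @[h --> 0^'+] --> (0 : R) &
    \forall h \near 0^'+, `|T t f x - T (t - h) f x| <= c h.
Proof.
move=> t0 [M fM]; have bf : bounded_fn f by exists M.
exists (fun h => 2 * M * (1 - T h (fun y => (y == x)%:R) x)).
  have := @markov_semigroup_cvg0 (fun y => (y == x)%:R) x (bounded_fn_indicator x).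
  rewrite eqxx => h1.
  rewrite -[X in _ --> X](_ : 2 * M * (1 - 1) = 0); last by rewrite subrr mulr0.
  by apply: cvgM; [exact: cvg_cst|apply: cvgB => //; exact: cvg_cst].
near=> h.
have h0 : 0 < h by near: h; exact: nbhs_right_gt.
have ht : h < t by near: h; exact: nbhs_right_lt.
have -> : T t f x = T h (T (t - h) f) x.
  by rewrite -(ms_comp mT) ?subr_ge0 ?(ltW h0) ?(ltW ht)// addrC subrK.
apply: markov_semigroup_displacement => y.
exact: markov_semigroup_norm_le.
Unshelve. all: by end_near. Qed.

End MarkovSemigroup.

(** * Comparison for the backward equation of two ordered copies *)

(** Continuous induction.  At a first failure time of a system of inequalities the
    right-hand condition comes from derivatives and the left-hand one from
    continuity. *)
Lemma real_induction {R : realType} (P : R -> Prop) :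
  P 0 ->
  (forall t, 0 <= t -> P t -> \forall h \near 0^'+, P (t + h)) ->
  (forall t, 0 < t -> (forall s, 0 <= s -> s < t -> P s) -> P t) ->
  forall t, 0 <= t -> P t.
Proof.
move=> P0 Pright Pleft t0 t0_ge0; apply: contrapT => nPt0.
pose A := [set t : R | 0 <= t /\ forall s, 0 <= s -> s <= t -> P s].
have A0 : A 0.
  by split => // s s0 s0'; have -> : s = 0 by apply/eqP; rewrite eq_le s0 s0'.
have supA : has_sup A.
  split; first by exists 0.
  exists t0 => t [_ At]; rewrite leNgt; apply/negP => /ltW t0t.
  exact/nPt0/At.
have sup0 : 0 <= sup A by apply: ub_le_sup => //; case: supA.
have Plt s : 0 <= s -> s < sup A -> P s.
  move=> s0 ssup; have [|t [_ At] st] := @sup_adherent _ A (sup A - s) _ supA.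
    by rewrite subr_gt0.
  by apply: At => //; move: st; rewrite opprB addrC subrK => /ltW.
have Psup : P (sup A).
  move: sup0; rewrite le_eqVlt => /predU1P[<- //|supA0]; exact: (Pleft _ supA0 Plt).
have : \forall h \near 0^'+, P (sup A + h) by exact: Pright.
move=> [e /= e0 He].
have : A (sup A + e / 2).
  split=> [|s s0 se]; first by rewrite addr_ge0// divr_ge0// ltW.
  have [ss|ss] := ltP s (sup A); first exact: Plt.
  move: ss; rewrite le_eqVlt => /predU1P[<- //|ss].
  have -> : s = sup A + (s - sup A) by rewrite addrC subrK.
  apply: He; rewrite /= ?subr_gt0// sub0r normrN gtr0_norm ?subr_gt0//.
  by rewrite ltrBlDl (le_lt_trans se)// ltrD2l ltr_pdivrMr// ltr_pMr// ltr1n.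
move=> /(ub_le_sup supA.2); rewrite leNgt => /negP; apply.
by rewrite ltrDl divr_gt0.
Qed.

Section Comparison.
Context {R : realType} (lambda nu : nat -> R) (T : R -> (nat -> R) -> nat -> R).
Hypothesis rates : birth_death_rates lambda nu.
Hypothesis mT : markov_semigroup T.
Let L := birth_death_generator lambda nu.
Hypothesis genL : forall f, bounded_fn f ->
  forall x, t^-1 * (T t f x - f x) @[t --> 0^'+] --> L f x.
Implicit Types f a b w psi : nat -> R.

Lemma birth_death_rates_ge0 x : 0 <= lambda x /\ 0 <= nu x.
Proof.
case: rates => l0 n0 nu0; split; first exact: ltW.
by case: x => [|x]; [rewrite nu0|exact: ltW].
Qed.

(** If [(i, j) |-> a j - b i + c] is nonnegative above the diagonal and vanishes
    at [(x, y)] with [x < y], then each neighbour reached by moving one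
    coordinate is still above or on the diagonal, so every term of the
    two-particle generator is nonnegative there. *)
Lemma generator_touching a b c x y : (x < y)%N ->
  (forall i j, (i <= j)%N -> 0 <= a j - b i + c) ->
  a y - b x + c = 0 ->
  0 <= L a y - L b x.
Proof.
move=> xy ab0 abxy.
have [ly ny] := birth_death_rates_ge0 y; have [lx nx] := birth_death_rates_ge0 x.
have h1 : 0 <= lambda y * (a y.+1 - a y).
  by rewrite mulr_ge0//; have := ab0 x y.+1 (leqW (ltnW xy)); lra.
have h2 : 0 <= nu y * (a y.-1 - a y).
  rewrite mulr_ge0//; have : (x <= y.-1)%N by case: y xy {abxy ly ny h1}.
  by move=> /ab0; lra.
have h3 : 0 <= lambda x * (b x - b x.+1).
  by rewrite mulr_ge0//; have := ab0 x.+1 y xy; lra.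
have h4 : 0 <= nu x * (b x - b x.-1).
  rewrite mulr_ge0//; have := ab0 x.-1 y (leq_trans (leq_pred x) (ltnW xy)); lra.
rewrite /L /birth_death_generator; lra.
Qed.

Variables (w psi : nat -> R) (alpha : R).
Hypothesis w_nd : forall x y, (x <= y)%N -> w x <= w y.
Hypothesis Lw : forall x y, (x <= y)%N -> L w y - L w x <= - alpha * (w y - w x).
Hypothesis psi_ge0 : forall x, 0 <= psi x.
Hypothesis Lpsi : forall x, L psi x = 1.
Hypothesis psi_oo : forall A : R, exists N, forall x, (N <= x)%N -> A <= psi x.

(** Comparison of [T t f y - T t f x] with its supersolution.  The factor 3 in the
    barrier beats the two units of drift that [L psi = 1] creates, one for each
    coordinate, and the summand 1 keeps the barrier positive at time 0. *)
Section Barrier.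
Variables (f : nat -> R) (M eps : R).
Hypothesis fM : forall x, `|f x| <= M.
Hypothesis f_le : forall x y, (x <= y)%N -> f y - f x <= w y - w x.
Hypothesis eps0 : 0 < eps.

Let bf : bounded_fn f. Proof. by exists M. Qed.

Let gap t x y :=
  expR (- (alpha * t)) * (w y - w x) + eps * (3 * t + 1 + psi x + psi y)
  - (T t f y - T t f x).

(** Beyond a finite set of pairs the term in [psi y] alone exceeds the bound
    [2 M] on [T t f y - T t f x]; this reduces the comparison to finitely many
    pairs. *)
Let gap_far : exists N, forall t x y,
  0 <= t -> (x <= y)%N -> (N <= y)%N -> 0 <= gap t x y.
Proof.
have [N HN] := psi_oo (2 * M / eps); exists N => t x y t0 xy Ny.
have h1 : 0 <= expR (- (alpha * t)) * (w y - w x).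
  by rewrite mulr_ge0 ?expR_ge0// subr_ge0 w_nd.
have h2 : 2 * M <= eps * psi y by rewrite [leRHS]mulrC -ler_pdivrMr// HN.
have h3 : 0 <= eps * (3 * t + 1 + psi x).
  by rewrite mulr_ge0 ?(ltW eps0)//; have := psi_ge0 x; lra.
have := markov_semigroup_norm_le mT t x fM; have := markov_semigroup_norm_le mT t y fM.
rewrite !ler_norml /gap; lra.
Qed.

(** At a touching pair the drift of [T t f y - T t f x] exceeds that of
    the supersolution by at most [2 eps], which is less than the [3 eps] gained
    per unit of time. *)
Let gap_touching t x y : 0 <= t -> (x < y)%N ->
  (forall i j, (i <= j)%N -> 0 <= gap t i j) -> gap t x y = 0 ->
  L (T t f) y - L (T t f) x + alpha * expR (- (alpha * t)) * (w y - w x)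
    <= 2 * eps.
Proof.
move=> t0 xy gt0 gtxy.
set E := expR (- (alpha * t)) in gt0 gtxy *.
have E0 : 0 <= E by exact: expR_ge0.
pose a z := E * w z + eps * psi z - T t f z.
pose b z := E * w z - eps * psi z - T t f z.
have LaE z : L a z = E * L w z + eps - L (T t f) z.
  rewrite -[X in _ + X - _]mulr1 -(Lpsi z) /L /birth_death_generator /a; ring.
have LbE z : L b z = E * L w z - eps - L (T t f) z.
  rewrite -[X in _ - X - _]mulr1 -(Lpsi z) /L /birth_death_generator /b; ring.
have abE i j : a j - b i + eps * (3 * t + 1) = gap t i j.
  by rewrite /a /b /gap -/E; ring.
have := @generator_touching a b (eps * (3 * t + 1)) x y xy.
rewrite LaE LbE abE => /(_ _ gtxy) h.
have {h} := h (fun i j ij => eq_ind_r (fun r => 0 <= r) (gt0 i j ij) (abE i j)).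
have := ler_wpM2l E0 (Lw (ltnW xy)); lra.
Qed.

(** If the inequality holds for all pairs at time [t], then it persists at a given
    pair for a short time: by continuity where it is strict, and where it is an
    equality because the right derivative of the gap is positive. *)
Let gap_right t x y : 0 <= t -> (x <= y)%N ->
  (forall i j, (i <= j)%N -> 0 <= gap t i j) ->
  \forall h \near 0^'+, 0 <= gap (t + h) x y.
Proof.
move=> t0 xy gt0.
have [<-|x_lt_y] := eqVneq x y.
  near=> h; rewrite /gap !subrr mulr0 add0r subr0 mulr_ge0 ?(ltW eps0)//.
  have h0 : 0 < h by near: h; exact: nbhs_right_gt.
  have := psi_ge0 x; lra.
have {x_lt_y} xy' : (x < y)%N by rewrite ltn_neqAle x_lt_y.
have bTf := markov_semigroup_bounded mT t bf.
set E := expR (- (alpha * t)).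
pose D h := h^-1 * (T h (T t f) y - T t f y) - h^-1 * (T h (T t f) x - T t f x)
  + alpha * E * (w y - w x).
pose D0 := L (T t f) y - L (T t f) x + alpha * E * (w y - w x).
have Dcvg : D h @[h --> 0^'+] --> D0.
  apply: cvgD; last exact: cvg_cst.
  by apply: cvgB; exact: genL.
have h_cvg : (h : R) @[h --> 0^'+] --> (0 : R).
  by apply: cvg_at_right_filter; exact: cvg_id.
have gap_ge h : 0 < h -> gap t x y + h * (3 * eps - D h) <= gap (t + h) x y.
  move=> h0; rewrite /gap [t + h]addrC !(ms_comp mT) ?(ltW h0)// /D.
  have -> : expR (- (alpha * (h + t))) = E * expR (- (alpha * h)).
    by rewrite /E -expRD; congr expR; ring.
  rewrite -/E.
  have := expR_ge1Dx (- (alpha * h)).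
  have : 0 <= E * (w y - w x) by rewrite mulr_ge0 ?expR_ge0// subr_ge0 w_nd.
  (* A lower bound on the gap suffices, so the exponential may be replaced by
     its tangent. *)
  move=> Ew0 /(ler_wpM2l Ew0).
  set X := T h (T t f) y; set Y := T h (T t f) x.
  have -> : h * (3 * eps - (h^-1 * (X - T t f y) - h^-1 * (Y - T t f x)
     + alpha * E * (w y - w x))) = 3 * h * eps - (X - T t f y) + (Y - T t f x)
     - h * alpha * E * (w y - w x).
    by field; rewrite gt_eqF.
  lra.
have := gt0 _ _ xy; rewrite le_eqVlt => /predU1P[gap0|gap_gt0].
  have D0_lt : D0 < 3 * eps.
    apply: (le_lt_trans (gap_touching t0 xy' gt0 (esym gap0))).
    by rewrite ltr_pM2r// ltr_nat.
  near=> h.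
  have h0 : 0 < h by near: h; exact: nbhs_right_gt.
  apply: le_trans (gap_ge _ h0); rewrite -gap0 add0r mulr_ge0 ?(ltW h0)//.
  rewrite subr_ge0 ltW//; near: h.
  exact: (cvgr_lt _ Dcvg).
have Gcvg : gap t x y + h * (3 * eps - D h) @[h --> 0^'+] --> gap t x y.
  rewrite -[X in _ --> X](_ : gap t x y + 0 * (3 * eps - D0) = _); last first.
    by rewrite mul0r addr0.
  apply: cvgD; first exact: cvg_cst.
  by apply: cvgM => //; apply: cvgB => //; exact: cvg_cst.
near=> h.
have h0 : 0 < h by near: h; exact: nbhs_right_gt.
apply: le_trans (gap_ge _ h0); apply: ltW; near: h.
exact: (cvgr_gt _ Gcvg).
Unshelve. all: by end_near. Qed.

Let gap_left t x y : 0 < t -> (x <= y)%N ->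
  (forall s, 0 <= s -> s < t -> 0 <= gap s x y) -> 0 <= gap t x y.
Proof.
move=> t0 xy gt0.
have [cx cx0 Hx] := markov_semigroup_left_increment mT genL x t0 bf.
have [cy cy0 Hy] := markov_semigroup_left_increment mT genL y t0 bf.
have h_cvg : (h : R) @[h --> 0^'+] --> (0 : R).
  by apply: cvg_at_right_filter; exact: cvg_id.
set E := expR (- (alpha * t)).
pose G h := E * expR (alpha * h) * (w y - w x) + eps * (3 * t + 1 + psi x + psi y)
   - (T t f y - T t f x) + (cx h + cy h).
have c0 : cx h + cy h @[h --> 0^'+] --> (0 : R).
  by rewrite -[X in _ --> X]addr0; exact: cvgD.
have a0 : alpha * h @[h --> 0^'+] --> (0 : R).
  by rewrite -[X in _ --> X](mulr0 alpha); apply: cvgM => //; exact: cvg_cst.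
have e1 : expR (alpha * h) @[h --> 0^'+] --> (1 : R).
  by rewrite -expR0; apply: cvg_comp a0 _; exact: continuous_expR.
have Gcvg : G h @[h --> 0^'+] --> gap t x y.
  rewrite /gap -/E -[X in _ --> X]addr0 -[X in X * (w y - w x)]mulr1.
  apply: cvgD => //; apply: cvgB; last exact: cvg_cst.
  apply: cvgD; last exact: cvg_cst.
  by apply: cvgM; [apply: cvgM => //; exact: cvg_cst|exact: cvg_cst].
apply: (cvgr_to_ge Gcvg); near=> h.
have h0 : 0 < h by near: h; exact: nbhs_right_gt.
have ht : h < t by near: h; exact: nbhs_right_lt.
have hx : `|T t f x - T (t - h) f x| <= cx h by near: h.
have hy : `|T t f y - T (t - h) f y| <= cy h by near: h.
have := gt0 (t - h); rewrite subr_ge0 gtrBl => /(_ (ltW ht) h0).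
have -> : gap (t - h) x y = E * expR (alpha * h) * (w y - w x)
    + eps * (3 * (t - h) + 1 + psi x + psi y) - (T (t - h) f y - T (t - h) f x).
  by rewrite /gap /E -expRD; congr (expR _ * _ + _ - _); ring.
have : 0 <= eps * h by rewrite mulr_ge0// ltW.
move: hx hy; rewrite !ler_norml /G; lra.
Unshelve. all: by end_near. Qed.

(** By continuous induction on time.  The pairs with [y < N] are finitely many, so
    that the short times given by [gap_right] have a common lower bound. *)
Lemma barrier t x y : 0 <= t -> (x <= y)%N ->
  T t f y - T t f x <=
  expR (- (alpha * t)) * (w y - w x) + eps * (3 * t + 1 + psi x + psi y).
Proof.
move=> t0 xy; rewrite -subr_ge0 -/(gap t x y).
have [N far] := gap_far.
suff /(_ t t0 _ _ xy) : forall s, 0 <= s ->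
  forall i j, (i <= j)%N -> 0 <= gap s i j by [].
apply: real_induction => [i j ij|s s0 Hs|s s0 Hs i j ij].
- rewrite /gap mulr0 oppr0 expR0 mul1r !(markov_semigroup0 mT)//.
  have := f_le ij; have : 0 <= eps * (3 * 0 + 1 + psi i + psi j).
    rewrite mulr_ge0 ?(ltW eps0)//; have := psi_ge0 i; have := psi_ge0 j; lra.
  lra.
- have near_all : \forall h \near 0^'+, forall ij : 'I_N * 'I_N,
      (ij.1 <= ij.2)%N -> 0 <= gap (s + h) ij.1 ij.2.
    apply: filter_forall => -[i j]; have [ij|ij] := boolP (i <= j)%N.
      by apply: filterS (gap_right s0 ij Hs).
    by apply: nearW => h ij'; case/negP: ij.
  near=> h => i j ij.
  have h0 : 0 < h by near: h; exact: nbhs_right_gt.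
  have [Nj|jN] := leqP N j; first by apply: far => //; rewrite addr_ge0// ltW.
  have iN : (i < N)%N by exact: leq_ltn_trans jN.
  suff /(_ (Ordinal iN, Ordinal jN) ij) : forall ij : 'I_N * 'I_N,
      (ij.1 <= ij.2)%N -> 0 <= gap (s + h) ij.1 ij.2 by [].
  by near: h.
- by apply: gap_left => // r r0 rs; exact: Hs.
Unshelve. all: by end_near. Qed.

End Barrier.

Lemma semigroup_contraction f t x y : bounded_fn f ->
  (forall x y, (x <= y)%N -> f y - f x <= w y - w x) ->
  0 <= t -> (x <= y)%N ->
  T t f y - T t f x <= expR (- (alpha * t)) * (w y - w x).
Proof.
move=> [M fM] f_le t0 xy.
set K := 3 * t + 1 + psi x + psi y.
have K0 : 0 < K.
  by rewrite /K; have := psi_ge0 x; have := psi_ge0 y; lra.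
apply/ler_addgt0Pr => e e0.
have := @barrier f M (e / K) fM f_le _ t x y t0 xy.
by rewrite -/K divfK ?gt_eqF//; apply; exact: divr_gt0.
Qed.

End Comparison.

(** * The mean passage time as a Lyapunov function *)

Section Lyapunov.
Context {R : realType} (lambda nu : nat -> R).
Hypothesis rates : birth_death_rates lambda nu.
Let L := birth_death_generator lambda nu.
Let mu := reversing_measure lambda nu.

Lemma reversing_measure_gt0 x : 0 < mu x.
Proof.
case: rates => l0 n0 _; rewrite /mu /reversing_measure divr_gt0//.
  by apply: prodr_gt0 => k _.
by rewrite big_add1 /=; apply: prodr_gt0 => k _.
Qed.

Lemma reversing_measureS x : mu x.+1 * nu x.+1 = mu x * lambda x.
Proof.
case: rates => l0 n0 _; rewrite /mu /reversing_measure.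
rewrite big_nat_recr//= [\prod_(1 <= k < x.+2) _]big_nat_recr//=.
have : \prod_(1 <= k < x.+1) nu k != 0.
  by rewrite big_add1 /= gt_eqF//; apply: prodr_gt0 => k _.
have := n0 x; rewrite lt0r => /andP[nx _] px.
by field; apply/andP.
Qed.

(** The expected time to go from 0 to [n]: the inner expression is the expected
    time from [y] to [y + 1]. *)
Definition mean_passage_time (n : nat) : R :=
  \sum_(0 <= y < n) (mu y * lambda y)^-1 * \sum_(0 <= x < y.+1) mu x.

Lemma mean_passage_timeS n : mean_passage_time n.+1 =
  mean_passage_time n + (mu n * lambda n)^-1 * \sum_(0 <= x < n.+1) mu x.
Proof. by rewrite /mean_passage_time big_nat_recr. Qed.

Lemma mean_passage_time_incr_ge0 n :
  0 <= (mu n * lambda n)^-1 * \sum_(0 <= x < n.+1) mu x.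
Proof.
case: rates => l0 n0 _.
apply: mulr_ge0; last by apply: sumr_ge0 => x _; exact: ltW (reversing_measure_gt0 _).
by rewrite invr_ge0 mulr_ge0 ?(ltW (l0 _)) ?(ltW (reversing_measure_gt0 _)).
Qed.

Lemma mean_passage_time_ge0 n : 0 <= mean_passage_time n.
Proof.
rewrite /mean_passage_time; apply: sumr_ge0 => y _.
exact: mean_passage_time_incr_ge0.
Qed.

Lemma mean_passage_time_nd : {homo mean_passage_time : m n / (m <= n)%N >-> m <= n}.
Proof.
apply: homo_leq => //; first exact: le_trans.
by move=> n; rewrite mean_passage_timeS lerDl mean_passage_time_incr_ge0.
Qed.

Lemma generator_mean_passage_time x : L mean_passage_time x = 1.
Proof.
case: rates => l0 n0 nu0; rewrite /L /birth_death_generator mean_passage_timeS.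
have mx := reversing_measure_gt0 x; have lx := l0 x.
case: x mx lx => [|x] mx lx /=.
  rewrite nu0 mul0r addr0 big_nat1; field.
  by rewrite !gt_eqF.
have m' := reversing_measure_gt0 x; have l' := l0 x.
rewrite [\sum_(0 <= _ < x.+2) _]big_nat_recr//= mean_passage_timeS.
have nE : nu x.+1 = mu x * lambda x / mu x.+1.
  by rewrite -reversing_measureS mulrC mulKf// gt_eqF.
rewrite nE; field.
by rewrite !gt_eqF.
Qed.

Hypothesis erg : ergodic lambda nu.

(** The series of ergodicity, summed first over the other index. *)
Lemma mean_passage_time_series : (\sum_(0 <= n <oo)
  ((mu n * lambda n)^-1 * \sum_(0 <= x < n.+1) mu x)%:E = +oo)%E.
Proof.
case: rates => l0 n0 nu0; case: erg => + _; rewrite -/mu => <-.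
have a0 y : 0 <= (mu y * lambda y)^-1.
  by rewrite invr_ge0 mulr_ge0 ?(ltW (l0 _)) ?(ltW (reversing_measure_gt0 _)).
have m0 y : 0 <= mu y by exact: ltW (reversing_measure_gt0 y).
transitivity (\sum_(0 <= x <oo) \sum_(0 <= y <oo)
    if (x <= y)%N then ((mu x)%:E * ((mu y * lambda y)^-1)%:E) else 0)%E; last first.
  apply: eq_eseriesr => x _.
  rewrite -nneseriesZl; last by move=> y _; rewrite lee_fin.
  apply: congr_lim; apply/funext => n /=.
  by rewrite -big_mkcond /= [RHS](big_nat_widenl x 0).
rewrite nneseries_interchange; last first.
  by move=> i j; case: ifP => // _; rewrite mule_ge0// lee_fin.
apply: eq_eseriesr => n _.
rewrite (nneseries_split 0 n.+1) => [|k _]; last first.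
  by case: ifP => // _; rewrite mule_ge0// lee_fin.
rewrite add0n [X in _ + X]eseries0 ?adde0 => [|k nk _]; last by rewrite leqNgt nk.
rewrite mulrC mulr_suml -sumEFin; apply: eq_big_nat => k /andP[_].
by rewrite ltnS => ->; rewrite EFinM.
Qed.

Lemma mean_passage_time_unbounded (A : R) :
  exists N, forall n, (N <= n)%N -> A <= mean_passage_time n.
Proof.
have [[N AN]|no] := pselect (exists N, A <= mean_passage_time N).
  by exists N => n Nn; exact: le_trans AN (mean_passage_time_nd Nn).
have : (+oo <= A%:E)%E; last by rewrite leye_eq.
rewrite -mean_passage_time_series; apply: lime_le.
  by apply: is_cvg_nneseries => n _ _; rewrite lee_fin mean_passage_time_incr_ge0.
apply: nearW => n; rewrite sumEFin lee_fin -/(mean_passage_time n).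
by rewrite leNgt; apply/negP => /ltW An; apply: no; exists n.
Qed.

End Lyapunov.

(** * Lipschitz functions for the path metric *)

Section PathMetric.
Context {R : realType} (lambda nu u : nat -> R).
Hypothesis rates : birth_death_rates lambda nu.
Hypothesis u_gt0 : forall x, 0 < u x.
Let L := birth_death_generator lambda nu.

Definition path_length (x : nat) : R := \sum_(0 <= k < x) u k.

(** The relative rate at which the generator shortens the edge between [x] and
    [x + 1], as [generator_path_length_increment] shows. *)
Definition contraction_rate (x : nat) : R :=
  nu x.+1 + lambda x - nu x * (upred u x / u x) - lambda x.+1 * (u x.+1 / u x).

Lemma path_lengthS x : path_length x.+1 = path_length x + u x.
Proof. by rewrite /path_length big_nat_recr. Qed.

Lemma path_length_nd x y : (x <= y)%N -> path_length x <= path_length y.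
Proof.
move=> /subnK <-; elim: (y - x)%N => // n IH.
by rewrite addSn path_lengthS (le_trans IH)// lerDl ltW.
Qed.

Lemma path_metricE x y : (x <= y)%N ->
  path_metric u x y = path_length y - path_length x.
Proof.
by move=> xy; rewrite /path_metric distrC ger0_norm// subr_ge0 path_length_nd.
Qed.

Lemma path_metricC x y : path_metric u x y = path_metric u y x.
Proof. exact: distrC. Qed.

Lemma path_metric_gt0 x y : x != y -> 0 < path_metric u x y.
Proof.
wlog xy : x y / (x < y)%N => [H|_].
  by rewrite neq_ltn => /orP[] h; [|rewrite path_metricC]; apply: H; rewrite // neq_ltn h.
rewrite path_metricE ?(ltnW xy)// subr_gt0.
apply: (@lt_le_trans _ _ (path_length x.+1)); last exact: path_length_nd.
by rewrite path_lengthS ltrDl.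
Qed.

Lemma path_metric_ge0 x y : 0 <= path_metric u x y.
Proof. exact: normr_ge0. Qed.

(** A jump of either end of the edge between [k] and [k + 1] replaces, adds or
    removes one neighbouring edge.  At [k = 0] the rate [nu 0 = 0] hides the
    default value of the predecessor. *)
Lemma generator_path_length_increment k :
  L path_length k.+1 - L path_length k = - contraction_rate k * u k.
Proof.
case: rates => _ _ nu0.
have uk := u_gt0 k; rewrite /L /birth_death_generator /contraction_rate !path_lengthS.
case: k uk => [|k] uk /=; first by rewrite nu0; field; rewrite gt_eqF.
by rewrite !path_lengthS; field; rewrite gt_eqF.
Qed.

Lemma generator_path_length alpha x y : (forall k, alpha <= contraction_rate k) ->
  (x <= y)%N ->
  L path_length y - L path_length x <= - alpha * (path_length y - path_length x).
Proof.
move=> alphaV /subnK <-; elim: (y - x)%N => [|n IH]; first by rewrite add0n !subrr mulr0.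
rewrite addSn path_lengthS.
have := generator_path_length_increment (n + x).
have : alpha * u (n + x)%N <= contraction_rate (n + x) * u (n + x)%N.
  by rewrite ler_pM2r.
move: IH; lra.
Qed.

Lemma lip_norm_le f (c : R) : 0 <= c ->
  (lip_norm (path_metric u) f <= c%:E)%E <->
  (forall x y, `|f x - f y| <= c * path_metric u x y).
Proof.
move=> c0; split=> [fc x y|fc].
  have [->|xy] := eqVneq x y; first by rewrite subrr normr0 mulr_ge0 ?path_metric_ge0.
  rewrite -ler_pdivrMr ?path_metric_gt0// -lee_fin; apply: le_trans fc.
  by apply: ereal_sup_ubound; exists (x, y).
apply: ge_ereal_sup => _ [[x y] /= xy <-].
by rewrite lee_fin ler_pdivrMr ?path_metric_gt0.
Qed.

Lemma lip_norm_ge f x :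
  (((f x.+1 - f x) / u x)%:E <= lip_norm (path_metric u) f)%E.
Proof.
apply: (@le_trans _ _ (`|f x.+1 - f x| / path_metric u x.+1 x)%:E).
  rewrite path_metricC path_metricE// path_lengthS addrAC subrr add0r.
  by rewrite lee_fin ler_pM2r ?invr_gt0// ler_norm.
by apply: ereal_sup_ubound; exists (x.+1, x) => //=; rewrite gtn_eqF.
Qed.

Lemma lip_norm_ge0 f : (0 <= lip_norm (path_metric u) f)%E.
Proof.
apply: (@le_trans _ _ (`|f 0%N - f 1%N| / path_metric u 0 1)%:E).
  by rewrite lee_fin divr_ge0// path_metric_ge0.
by apply: ereal_sup_ubound; exists (0%N, 1%N).
Qed.

(** The path length stopped beyond [x + 2]: it has unit slope everywhere that
    the generator looks from [x] and [x + 1], but it is bounded. *)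
Definition stopped_length x (n : nat) : R := path_length (minn n x.+2).

Lemma stopped_lengthE x n :
  (n <= x.+2)%N -> stopped_length x n = path_length n.
Proof. by move=> nx; rewrite /stopped_length (minn_idPl nx). Qed.

Lemma stopped_length_bounded x : bounded_fn (stopped_length x).
Proof.
exists (path_length x.+2) => n; rewrite ger0_norm.
  by apply: path_length_nd; exact: geq_minr.
by rewrite -[0](_ : path_length 0 = _) ?path_length_nd// /path_length big_nil.
Qed.

(** The bound 1 is attained on the edge between 0 and 1. *)
Lemma lip_norm_stopped_length x : lip_norm (path_metric u) (stopped_length x) = 1%E.
Proof.
apply/eqP; rewrite eq_le; apply/andP; split.
  apply/lip_norm_le => // i j; rewrite mul1r.
  wlog ij : i j / (i <= j)%N => [H|].
    have [/H//|/ltnW /H] := leqP i j.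
    by rewrite distrC path_metricC.
  have mij : (minn i x.+2 <= minn j x.+2)%N.
    by rewrite leq_min geq_minr andbT (leq_trans (geq_minl _ _)).
  rewrite path_metricE// distrC ger0_norm ?subr_ge0 ?path_length_nd//.
  rewrite /stopped_length; have [jx|jx] := leqP j x.+2.
    have ix := leq_trans ij jx.
    by rewrite (minn_idPl ix).
  have [ix|ix] := leqP i x.+2.
    by rewrite lerB// path_length_nd// ltnW.
  by rewrite subrr subr_ge0 path_length_nd.
apply: le_trans (lip_norm_ge _ 0).
rewrite !stopped_lengthE// path_lengthS addrAC subrr add0r.
by rewrite divff// gt_eqF.
Qed.

Lemma generator_stopped_length x :
  L (stopped_length x) x.+1 - L (stopped_length x) x = - contraction_rate x * u x.
Proof.
rewrite -generator_path_length_increment /L /birth_death_generator /=.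
have x0 : (x <= x.+2)%N by exact: leqW (leqnSn x).
have x1 : (x.-1 <= x.+2)%N by exact: leq_trans (leq_pred x) x0.
by rewrite !stopped_lengthE.
Qed.

End PathMetric.

(** * The two bounds on the curvature *)

Section Clamp.
Context {R : realType}.

Definition clamp (M r : R) : R := Num.max (- M) (Num.min M r).

Lemma clamp_norm_le M r : 0 <= M -> `|clamp M r| <= M.
Proof.
move=> M0; rewrite /clamp ler_norml; apply/andP; split.
  by rewrite le_max lexx.
by rewrite ge_max ge_min lexx andbT; lra.
Qed.

Lemma clamp_norm_le_id M r : 0 <= M -> `|clamp M r| <= `|r|.
Proof.
move=> M0; have r0 := normr_ge0 r.
rewrite /clamp ler_norml ge_max ge_min ler_norm orbT andbT le_max le_min.
have rN : - `|r| <= r by rewrite lerNl -normrN ler_norm.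
by rewrite rN andbT; apply/andP; split; [apply/orP; right|]; lra.
Qed.

Lemma clamp_id M r : `|r| <= M -> clamp M r = r.
Proof. by rewrite ler_norml => /andP[Mr rM]; rewrite /clamp min_r// max_r. Qed.

Lemma clampB_le M r s c : 0 <= M -> 0 <= c -> r - s <= c -> clamp M r - clamp M s <= c.
Proof.
move=> M0 c0 rs; rewrite /clamp.
case: (leP M r) => Mr; case: (leP M s) => Ms;
  rewrite ?[Num.max (- M) M]max_r; try (by lra);
  try case: (leP (- M) r) => ?; try case: (leP (- M) s) => ?; lra.
Qed.

End Clamp.

Section Curvature.
Context {R : realType} {d : measure_display} {Omega : measurableType d}.
Variables (Px : nat -> probability Omega R) (X : R -> {mfun Omega >-> nat}).
Variables (lambda nu u : nat -> R).
Hypothesis bdp : birth_death_process Px X lambda nu.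
Hypothesis erg : ergodic lambda nu.
Hypothesis u_gt0 : forall x, 0 < u x.
Hypothesis moment : forall (t : R) (x : nat), 0 < t ->
  finite_delta_moment (path_metric u) (transition Px X t x).
Let T := semigroup Px X.
Let delta := path_metric u.
Let V := contraction_rate lambda nu u.
Let w := path_length u.
Let L := birth_death_generator lambda nu.

Let mT : markov_semigroup T.
Proof. exact: semigroup_markov (bdp_markov bdp) (bdp_start bdp). Qed.

Let genL f : bounded_fn f ->
  forall x, t^-1 * (T t f x - f x) @[t --> 0^'+] --> L f x.
Proof. exact: (bdp_generator bdp). Qed.

(** A Lipschitz function grows at most like the distance to a fixed point, whose
    expectation is the finite moment. *)
Lemma integrable_lipschitz f t x : 0 < t ->
  (forall i j, `|f i - f j| <= delta i j) ->
  (Px x).-integrable setT (EFin \o (fun w => f (X t w))).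
Proof.
move=> t0 flip; have [z zfin] := moment x t0.
have dint : (Px x).-integrable setT (EFin \o (fun w => delta z (X t w))).
  apply/integrableP; split.
    by apply/measurable_EFinP; exact: (measurable_path X t (delta z)).
  under eq_integral do rewrite /= ger0_norm ?path_metric_ge0//.
  by rewrite (@integral_path _ _ _ Px X t x (delta z))// => y; exact: path_metric_ge0.
have cint : (Px x).-integrable setT (EFin \o (fun w => `|f z|)).
  exact: (@integrable_path _ _ _ Px X t (fun=> `|f z|) x (bounded_fn_cst _)).
apply: (le_integrable measurableT _ _ (integrableD measurableT cint dint)).
  by apply/measurable_EFinP; exact: (measurable_path X t f).
move=> v _ /=; rewrite lee_fin [leRHS]ger0_norm ?addr_ge0 ?path_metric_ge0//.
have := flip z (X t v); have := ler_normB (f z) (f z - f (X t v)).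
have -> : f z - (f z - f (X t v)) = f (X t v) by ring.
lra.
Qed.

Lemma semigroup_clamp_cvg f t x : 0 < t ->
  (forall i j, `|f i - f j| <= delta i j) ->
  T t (fun y => clamp n%:R (f y)) x @[n --> \oo] --> T t f x.
Proof.
move=> t0 flip; rewrite /T; under eq_fun do rewrite semigroupE.
rewrite semigroupE; have fint := integrable_lipschitz x t0 flip.
apply: fine_cvg; rewrite fineK; last exact: integrable_fin_num.
have [||||| _ _ //] := @dominated_convergence _ _ _ (Px x) setT measurableT
  (fun n v => (clamp n%:R (f (X t v)))%:E) (fun v => (f (X t v))%:E)
  (fun v => `|f (X t v)|%:E).
- move=> n; apply/measurable_EFinP.
  exact: (measurable_path X t (fun y => clamp n%:R (f y))).
- by apply/measurable_EFinP; exact: (measurable_path X t f).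
- apply: aeW => v _; apply: cvg_near_cst; near=> n; rewrite clamp_id//.
  by near: n; exact: nbhs_infty_ger.
- exact: integrable_abse fint.
- by apply: aeW => v n _ /=; rewrite lee_fin clamp_norm_le_id.
Unshelve. all: by end_near. Qed.

(** Clamping a Lipschitz function and changing its sign keep it below the path
    length, so that the contraction of bounded functions applies in both
    directions and passes to the limit of the clamping level. *)
Lemma semigroup_lipschitz alpha f t : (forall x, alpha <= V x) -> 0 < t ->
  (forall i j, `|f i - f j| <= delta i j) ->
  forall x y, `|T t f x - T t f y| <= expR (- (alpha * t)) * delta x y.
Proof.
move=> aV t0 flip.
have contract g x y : bounded_fn g ->
    (forall i j, (i <= j)%N -> g j - g i <= w j - w i) -> (x <= y)%N ->
    T t g y - T t g x <= expR (- (alpha * t)) * (w y - w x).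
  move=> bg g_le xy.
  apply: (semigroup_contraction (bdp_rates bdp) mT genL
    (psi := mean_passage_time lambda nu)) => //.
  - exact: path_length_nd.
  - by move=> a b; apply: (generator_path_length (bdp_rates bdp) u_gt0 aV).
  - exact: mean_passage_time_ge0 (bdp_rates bdp).
  - exact: generator_mean_passage_time (bdp_rates bdp).
  - exact: mean_passage_time_unbounded (bdp_rates bdp) erg.
  - exact: ltW.
move=> x y; wlog xy : x y / (x <= y)%N => [H|].
  by have [/H//|/ltnW /H] := leqP x y; rewrite distrC /delta path_metricC.
rewrite distrC /delta path_metricE//.
have clim : `|T t (fun y => clamp n%:R (f y)) y - T t (fun y => clamp n%:R (f y)) x|
    @[n --> \oo] --> `|T t f y - T t f x|.
  by apply: cvg_norm; apply: cvgB; exact: semigroup_clamp_cvg.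
apply: (cvgr_to_le clim); apply: nearW => n.
set g := fun y => clamp n%:R (f y).
have bg : bounded_fn g by exists n%:R => a; exact: clamp_norm_le.
have g_le i j : (i <= j)%N -> `|g j - g i| <= w j - w i.
  move=> ij; have w0 : 0 <= w j - w i by rewrite subr_ge0 path_length_nd.
  have := flip i j; rewrite /delta path_metricE// ler_norml => /andP[fN fP].
  rewrite ler_norml lerNl opprB; apply/andP; split; apply: clampB_le => //.
  by rewrite -opprB lerNl.
rewrite ler_norml; apply/andP; split.
  have := contract _ x y (bounded_fnZ (-1) bg); rewrite !(ms_scale mT)//.
  rewrite !mulN1r -opprD lerNl; apply => // i j ij; rewrite !mulN1r -opprD.
  by rewrite lerNl; have := g_le i j ij; rewrite ler_norml => /andP[].
apply: contract => // i j ij; exact: le_trans (ler_norm _) (g_le _ _ ij).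
Qed.

(** Valid at every positive time, since the contraction estimate is not
    asymptotic. *)
Lemma curvature_upto_ge alpha t : (forall x, alpha <= V x) -> 0 < t ->
  (alpha%:E <= curvature_upto Px X delta t * (t^-1)%:E)%E.
Proof.
move=> aV t0; rewrite lee_pdivlMr// -EFinM leeNr -EFinN.
apply: ge_ereal_sup => _ [f /= f1 <-].
rewrite -[X in (_ <= X%:E)%E]expRK -lne_EFin ?expR_gt0//.
rewrite lee_lne ?in_itv/= ?leey ?andbT ?lee_fin ?expR_ge0 ?lip_norm_ge0//.
apply: (iffRL (lip_norm_le u_gt0 _ (expR_ge0 _))).
apply: semigroup_lipschitz => // i j; rewrite -[leRHS]mul1r.
by apply: (iffLR (lip_norm_le u_gt0 f ler01)); rewrite f1.
Qed.

(** With slope [r t = 1 + t * c t] of the evolved test function and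
    [c t -> - V x], the inequality [ln s <= s - 1] at [s = 1 / r t] bounds
    [- ln (r t) / t] by [- c t / (1 + t * c t)], which tends to [V x]. *)
Lemma curvature_upto_le x (e : R) : 0 < e -> \forall t \near 0^'+,
  (curvature_upto Px X delta t * (t^-1)%:E <= (V x + e)%:E)%E.
Proof.
move=> e0; pose f := stopped_length u x.
have bf : bounded_fn f by exact: stopped_length_bounded.
pose r t := (T t f x.+1 - T t f x) / u x.
pose c t := (t^-1 * (T t f x.+1 - f x.+1) - t^-1 * (T t f x - f x)) / u x.
have f_slope : f x.+1 - f x = u x.
  by rewrite /f !stopped_lengthE ?path_lengthS 1?addrC ?addKr// leqW.
have c_cvg : c t @[t --> 0^'+] --> - V x.
  rewrite -[X in _ --> X](_ : (L f x.+1 - L f x) / u x = _); last first.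
    by rewrite (generator_stopped_length (bdp_rates bdp))// mulfK// gt_eqF.
  by apply: cvgM; [apply: cvgB; exact: genL|exact: cvg_cst].
have t_cvg : (t : R) @[t --> 0^'+] --> (0 : R).
  by apply: cvg_at_right_filter; exact: cvg_id.
have d_cvg : 1 + t * c t @[t --> 0^'+] --> (1 : R).
  rewrite -[X in _ --> X](_ : 1 + 0 * - V x = _); last by rewrite mul0r addr0.
  by apply: cvgD; [exact: cvg_cst|exact: cvgM].
have q_cvg : - c t / (1 + t * c t) @[t --> 0^'+] --> V x.
  rewrite -[X in _ --> X](_ : - (- V x) / 1 = _); last by rewrite opprK divr1.
  by apply: cvgM; [exact: cvgN|apply: cvgV => //; exact: oner_neq0].
have rE t : 0 < t -> r t = 1 + t * c t.
  move=> t0; have fS : f x.+1 = f x + u x by rewrite -f_slope addrC subrK.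
  by rewrite /r /c fS; field; rewrite !gt_eqF.
near=> t.
have t0 : 0 < t by near: t; exact: nbhs_right_gt.
have d0 : 0 < 1 + t * c t by near: t; exact: (cvgr_gt _ d_cvg).
rewrite lee_pdivrMr// -EFinM leeNl -EFinN.
apply: (@le_trans _ _ (lne (lip_norm delta (T t f)))); last first.
  by apply: ereal_sup_ubound; exists f => //=; exact: lip_norm_stopped_length.
apply: (@le_trans _ _ (lne (1 + t * c t)%:E)); last first.
  rewrite lee_lne ?in_itv/= ?leey ?andbT ?lip_norm_ge0 ?lee_fin ?(ltW d0)//.
  by rewrite -rE//; exact: (lip_norm_ge u_gt0 (T t f) x).
rewrite lne_EFin// lee_fin lerNl -lnV ?posrE//.
have -> : (1 + t * c t)^-1 = 1 + t * (- c t / (1 + t * c t)).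
  by field; rewrite gt_eqF.
apply: (le_trans (le_ln1Dx _)).
  have -> : t * (- c t / (1 + t * c t)) = (1 + t * c t)^-1 - 1.
    by field; rewrite gt_eqF.
  by rewrite -ltrBlDr addrN invr_gt0.
rewrite mulrC ler_pM2r// ltW//; near: t.
by apply: (cvgr_lt _ q_cvg); rewrite ltrDl.
Unshelve. all: by end_near. Qed.

End Curvature.

(** A family squeezed between every lower bound of [V] and, eventually, every
    value of [V] up to an error, tends to the infimum of [V]. *)
Lemma cvg_ereal_inf {R : realType} {I T : Type} (F : set_system T)
    {FF : ProperFilter F} (h : T -> \bar R) (V : I -> R) (i0 : I) :
  (forall a, (forall i, a <= V i) -> \forall t \near F, (a%:E <= h t)%E) ->
  (forall i e, 0 < e -> \forall t \near F, (h t <= (V i + e)%:E)%E) ->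
  h t @[t --> F] --> ereal_inf (range (fun i => (V i)%:E)).
Proof.
move=> h_ge h_le; set l := ereal_inf _.
have l_le i : (l <= (V i)%:E)%E by apply: ereal_inf_lbound; exists i.
have h_lt (A : R) : (l < A%:E)%E -> \forall t \near F, (h t <= A%:E)%E.
  move=> /ereal_inf_lt[_ [i _ <-]]; rewrite lte_fin => VA.
  have := h_le i (A - V i); rewrite subr_gt0 addrC subrK; exact.
case lE: l => [r| |].
- have h_r : \forall t \near F, (r%:E <= h t)%E.
    by apply: h_ge => i; rewrite -lee_fin -lE.
  have h_re e : 0 < e -> \forall t \near F, (h t <= (r + e)%:E)%E.
    by move=> e0; apply: h_lt; rewrite lE lte_fin ltrDl.
  apply/fine_cvgP; split.
    near=> t; have rt : (r%:E <= h t)%E by near: t.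
    have tr : (h t <= (r + 1)%:E)%E by near: t; exact: h_re.
    by rewrite fin_numE; case: (h t) rt tr.
  apply/cvgrPdist_le => e e0; near=> t.
  have rt : (r%:E <= h t)%E by near: t.
  have tr : (h t <= (r + e)%:E)%E by near: t; exact: h_re.
  rewrite /=; case: (h t) rt tr => //= s; rewrite !lee_fin => rs sr.
  by rewrite distrC ger0_norm ?subr_ge0// lerBlDl.
- by have := l_le i0; rewrite lE.
- by apply/cvgeNyPle => A; apply: h_lt; rewrite lE ltNyr.
Unshelve. all: by end_near. Qed.

Theorem theorem4p3 (R : realType) (d : measure_display)
    (Omega : measurableType d) (Px : nat -> probability Omega R)
    (X : R -> {mfun Omega >-> nat}) (lambda nu u : nat -> R) :
  birth_death_process Px X lambda nu ->
  ergodic lambda nu ->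
  (forall x, 0 < u x) ->
  (forall (t : R) (x : nat), 0 < t ->
     finite_delta_moment (path_metric u) (transition Px X t x)) ->
  wasserstein_curvature Px X (path_metric u) =
  ereal_inf (range (fun x : nat =>
    (nu x.+1 + lambda x - nu x * (upred u x / u x)
     - lambda x.+1 * (u x.+1 / u x))%:E)).
Proof.
move=> bdp erg u_gt0 moment; apply/cvg_lim => //.
apply: (cvg_ereal_inf (V := contraction_rate lambda nu u) 0%N).
- move=> a aV; near=> t; have t0 : 0 < t by near: t; exact: nbhs_right_gt.
  exact: (curvature_upto_ge bdp erg u_gt0 moment).
- move=> x e e0; exact: (curvature_upto_le bdp u_gt0).
Unshelve. all: by end_near. Qed.
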